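(* Let $\Pi$ be a partition of $[n]$. (i) If $\delta_n\notin S_\Pi$, then $\mathrm{Comp}_{n+1}(S_\Pi) = S_{\Pi'}$. (ii) If $\delta_n\in S_\Pi$, then $\mathrm{Comp}_{n+1}(S_\Pi) = S_{\Pi'}\cup \delta_{n+1}S_{\Pi'} = \langle S_{\Pi'},\delta_{n+1}\rangle$; moreover $\Pi' = \delta_{n+1}(\Pi')$.
   Context: $S_n$ is the symmetric group on $[n]=\{1,\dots,n\}$ (composition right to left); $\delta_n$ is $i\mapsto n+1-i$. For a partition $\Pi$ of $[n]$, $S_\Pi=\{\pi\in S_n: \pi(B)=B \text{ for every block } B\in\Pi\}$, and $\delta_n(\Pi)=\{\delta_n(B):B\in\Pi\}$. Let $\widehat{\Pi}$ be the coarsest partition of $[n]$ into intervals that refines $\Pi$; let $[1]_{\widehat\Pi}$ and $[n]_{\widehat\Pi}$ be its blocks containing $1$ and $n$. Define partitions of $[n+1]$: $\widehat\Pi^{1}=\{B+1 : B\in\widehat\Pi,\,1\notin B\}\cup\{([1]_{\widehat\Pi}+1)\cup\{1\}\}$ (where $B+1=\{x+1:x\in B\}$) and $\widehat\Pi^{n+1}=\{B: B\in\widehat\Pi,\, n\notin B\}\cup\{[n]_{\widehat\Pi}\cup\{n+1\}\}$. Then $\Pi'$ is the coarsest common refinement of $\widehat\Pi^1$ and $\widehat\Pi^{n+1}$ (a partition of $[n+1]$). A permutation $\pi\in S_m$ involves $\tau\in S_n$ ($n\le m$) if there are indices $i_1<\dots<i_n$ with $\pi(i_j)<\pi(i_k)$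 iff $\tau(j)<\tau(k)$ for all $j,k$; such $\tau$ is an $n$-pattern of $\pi$. For $S\subseteq S_n$, $\mathrm{Comp}_m(S)$ is the set of all $\tau\in S_m$ all of whose $n$-patterns belong to $S$. *)

(* Defs.v *)
From HB Require Import structures.
From mathcomp Require Import all_boot all_fingroup.
From mathcomp Require Import zify.

Set Implicit Arguments.
Unset Strict Implicit.
Unset Printing Implicit Defensive.

(* [n] = {1, ..., n} is 'I_n, the element k being represented by the ordinal
   k - 1.  A partition of [n] is a P : {set {set 'I_n}} with
   partition P [set: 'I_n]. *)

Section Coarsest.
Variable T : finType.
Implicit Types P Q : {set {set T}}.

Definition refines Q P : bool :=
  [forall B in Q, [exists C in P, B \subset C]].

Definition is_coarsest (good : pred {set {set T}}) Q : bool :=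
  [&& partition Q [set: T], good Q &
      [forall Q', partition Q' [set: T] && good Q' ==> refines Q' Q]].

(* The default value set0 is never reached below: see hatP and prime_partP. *)
Definition coarsest (good : pred {set {set T}}) : {set {set T}} :=
  odflt set0 [pick Q | is_coarsest good Q].

Definition meet P1 P2 : {set {set T}} :=
  coarsest (fun Q => refines Q P1 && refines Q P2).

Lemma coarsestP good Q : is_coarsest good Q -> is_coarsest good (coarsest good).
Proof.
rewrite /coarsest; case: pickP => [Q' //|no_Q /=].
by rewrite no_Q.
Qed.

Lemma refinesP Q P :
  reflect (forall B, B \in Q -> exists2 C, C \in P & B \subset C) (refines Q P).
Proof.
apply: (iffP forall_inP) => h B /h.
  by case/exists_inP=> C PC sBC; exists C.
by case=> C PC sBC; apply/exists_inP; exists C.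
Qed.

Lemma refines_same Q P B x y : refines Q P -> partition P [set: T] ->
  B \in Q -> x \in B -> y \in B -> pblock P x = pblock P y.
Proof.
move=> /refinesP rQP /and3P[_ tiP _] /rQP[C PC /subsetP sBC] Bx By.
by rewrite !(def_pblock tiP PC) ?sBC.
Qed.

Lemma mem_pblockT P x : partition P [set: T] -> x \in pblock P x.
Proof. by case/and3P=> /eqP cP _ _; rewrite mem_pblock cP. Qed.

Lemma pblock_memT P x : partition P [set: T] -> pblock P x \in P.
Proof. by case/and3P=> /eqP cP _ _; rewrite pblock_mem ?cP. Qed.

Lemma meetP P1 P2 : partition P1 [set: T] -> partition P2 [set: T] ->
  is_coarsest (fun Q => refines Q P1 && refines Q P2) (meet P1 P2).
Proof.
move=> pP1 pP2.
set f := fun x => (pblock P1 x, pblock P2 x).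
apply: (@coarsestP _ (preim_partition f [set: T])); apply/and3P; split.
- exact: preim_partitionP.
- apply/andP; split; apply/refinesP=> B /imsetP[x _ ->].
    exists (pblock P1 x); first exact: pblock_memT.
    apply/subsetP=> y; rewrite !inE => /eqP[-> _]; exact: mem_pblockT.
  exists (pblock P2 x); first exact: pblock_memT.
  apply/subsetP=> y; rewrite !inE => /eqP[_ ->]; exact: mem_pblockT.
- apply/forallP=> Q; apply/implyP=> /and3P[pQ rQ1 rQ2].
  apply/refinesP=> B QB.
  have [x Bx] := set0Pn _ (partition_neq0 pQ QB).
  exists (pblock (preim_partition f [set: T]) x).
    by apply: pblock_memT; apply: preim_partitionP.
  apply/subsetP=> y By.
  rewrite pblock_equivalence_partition ?inE //; last by split=> // /eqP->.
  rewrite /f xpair_eqE (refines_same rQ1 pP1 QB Bx By).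
  by rewrite (refines_same rQ2 pP2 QB Bx By) !eqxx.
Qed.

End Coarsest.

Definition interval n (B : {set 'I_n}) : bool :=
  [forall i in B, forall k in B, forall j : 'I_n, (i <= j <= k) ==> (j \in B)].

Definition hat n (P : {set {set 'I_n}}) : {set {set 'I_n}} :=
  coarsest (fun Q => [forall B in Q, interval B] && refines Q P).

Lemma hatP n (P : {set {set 'I_n}}) : partition P [set: 'I_n] ->
  is_coarsest (fun Q => [forall B in Q, interval B] && refines Q P) (hat P).
Proof.
move=> pP.
pose r := fun x y : 'I_n =>
  [forall z : 'I_n, (minn x y <= z <= maxn x y) ==> (pblock P z == pblock P x)].
have rP (x y : 'I_n) : reflect (forall z : 'I_n, minn x y <= z <= maxn x y ->
                         pblock P z = pblock P x) (r x y).
  apply: (iffP forallP) => h z; first by move=> ?; apply/eqP/(implyP (h z)).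
  by apply/implyP=> ?; apply/eqP/h.
have r_refl (x : 'I_n) : r x x.
  by apply/rP=> z zx; congr (pblock P _); apply: val_inj => /=; lia.
have r_sym (x y : 'I_n) : r x y -> r y x.
  move=> /rP rxy; apply/rP=> z zx; rewrite (rxy y) ?rxy //; lia.
have r_trans (x y z : 'I_n) : r x y -> r y z -> r x z.
  move=> /rP rxy /rP ryz; apply/rP=> w wz.
  have [wxy|nwxy] := boolP (minn x y <= w <= maxn x y); first exact: rxy.
  by rewrite ryz ?(rxy y) //; lia.
have r_eqv : {in [set: 'I_n] & &, equivalence_rel r}.
  move=> x y z _ _ _; split=> // rxy; apply/idP/idP => h.
    exact: r_trans (r_sym _ _ rxy) h.
  exact: r_trans rxy h.
apply: (@coarsestP _ _ (equivalence_partition r [set: 'I_n])).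
have pR := equivalence_partitionP r_eqv.
apply/and3P; split=> //.
- apply/andP; split.
    apply/forall_inP=> _ /imsetP[x _ ->].
    apply/forall_inP=> i; rewrite !inE => rxi.
    apply/forall_inP=> k; rewrite !inE => rxk.
    apply/forallP=> j; apply/implyP=> ijk; rewrite !inE.
    apply/rP=> w wj; have [wxi|nwxi] := boolP (minn x i <= w <= maxn x i).
      exact: (rP _ _ rxi).
    by apply: (rP _ _ rxk); lia.
  apply/refinesP=> _ /imsetP[x _ ->].
  exists (pblock P x); first exact: pblock_memT.
  apply/subsetP=> y; rewrite !inE => /rP rxy.
  by rewrite -(rxy y) ?mem_pblockT //; lia.
- apply/forallP=> Q; apply/implyP=> /and3P[pQ iQ rQ].
  apply/refinesP=> B QB.
  have [x Bx] := set0Pn _ (partition_neq0 pQ QB).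
  exists (pblock (equivalence_partition r [set: 'I_n]) x).
    exact: pblock_memT.
  apply/subsetP=> y By.
  rewrite pblock_equivalence_partition ?inE //; apply/rP=> z zxy.
  apply: (refines_same rQ pP QB _ Bx).
  have iB := forall_inP iQ _ QB.
  have [lexy|ltyx] := leqP x y.
    by apply: (implyP (forallP (forall_inP (forall_inP iB _ Bx) _ By) z)); lia.
  by apply: (implyP (forallP (forall_inP (forall_inP iB _ By) _ Bx) z)); lia.
Qed.

(* On representatives, lift ord0 is x |-> x + 1 and widen_ord is x |-> x; ord0
   and ord_max represent the least and greatest elements of [n.+1] or [n.+2]. *)
Definition add_first n (Q : {set {set 'I_n.+1}}) : {set {set 'I_n.+2}} :=
  [set lift ord0 @: B | B : {set 'I_n.+1} in Q & ord0 \notin B]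
  :|: [set lift ord0 @: pblock Q ord0 :|: [set ord0]].

Definition add_last n (Q : {set {set 'I_n.+1}}) : {set {set 'I_n.+2}} :=
  let w := widen_ord (leqnSn n.+1) in
  [set w @: B | B : {set 'I_n.+1} in Q & ord_max \notin B]
  :|: [set w @: pblock Q ord_max :|: [set ord_max]].

Definition prime_part n (P : {set {set 'I_n.+1}}) : {set {set 'I_n.+2}} :=
  meet (add_first (hat P)) (add_last (hat P)).

Lemma partition_extend (T T' : finType) (h : T -> T') (a : T) (b : T')
    (Q : {set {set T}}) :
  injective h -> (forall x, h x != b) ->
  (forall y, y != b -> exists x, y = h x) -> partition Q [set: T] ->
  partition ([set h @: B | B : {set T} in Q & a \notin B]
             :|: [set h @: pblock Q a :|: [set b]]) [set: T'].
Proof.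
move=> hI hb hS pQ.
have /and3P[_ tiQ _] := pQ.
set A := h @: pblock Q a :|: [set b].
have bN (B : {set T}) : b \notin h @: B.
  by apply/imsetP=> -[x _ /esym/eqP]; rewrite (negbTE (hb x)).
have dis (B : {set T}) : B \in Q -> a \notin B -> [disjoint h @: B & A].
  move=> QB aB; apply/pred0P=> y /=; apply/negP=> /andP[hBy].
  rewrite !inE => /orP[|/eqP yb]; last by move: (bN B); rewrite -yb hBy.
  case/imsetP: hBy => x Bx -> ; rewrite mem_imset // => ax.
  move: aB; rewrite -(def_pblock tiQ QB Bx).
  by rewrite (same_pblock tiQ ax) mem_pblockT.
apply/and3P; split.
- apply/eqP/setP=> y; rewrite inE; apply/bigcupP.
  have [->|/hS[x ->]] := eqVneq y b.
    by exists A; rewrite !inE eqxx orbT.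
  have [ax|nax] := boolP (a \in pblock Q x).
    exists A; rewrite !inE ?eqxx ?orbT // mem_imset //.
    by rewrite (same_pblock tiQ ax) mem_pblockT.
  exists (h @: pblock Q x); last by rewrite mem_imset ?mem_pblockT.
  rewrite inE; apply/orP; left; apply/imsetP; exists (pblock Q x) => //.
  by rewrite inE pblock_memT.
- apply/trivIsetP=> B C; rewrite !inE.
  move=> /orP[/imsetP[B0 + ->]|/eqP->] /orP[/imsetP[C0 + ->]|/eqP->].
  + rewrite !inE => /andP[QC _] /andP[QB _] neq; rewrite imset_disjoint //.
    by apply: (trivIsetP tiQ) => //; apply: contraNneq neq => ->.
  + by rewrite inE => /andP[QB aB] _; apply: dis.
  + by rewrite inE => /andP[QB aB] _; rewrite disjoint_sym; apply: dis.
  + by rewrite eqxx.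
- rewrite !inE negb_or; apply/andP; split.
    apply/imsetP=> -[B]; rewrite inE => /andP[QB _] /esym/eqP.
    by rewrite imset_eq0; apply/negP/(partition_neq0 pQ QB).
  by apply/negP=> /eqP/setP/(_ b); rewrite !inE eqxx orbT.
Qed.

Lemma prime_partP n (P : {set {set 'I_n.+1}}) : partition P [set: 'I_n.+1] ->
  is_coarsest (fun Q => refines Q (add_first (hat P))
                        && refines Q (add_last (hat P))) (prime_part P).
Proof.
move=> /hatP/and3P[pH _ _]; apply: meetP; apply: partition_extend => //.
- exact: lift_inj.
- by move=> y; rewrite eq_sym => /unlift_some[x ->]; exists x.
- by move=> x y /(congr1 val) /= /val_inj.
- by move=> x; rewrite -val_eqE /=; have := ltn_ord x; lia.
- move=> y; rewrite -val_eqE /= => ny.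
  have yn : y < n.+1 by have := ltn_ord y; lia.
  by exists (Ordinal yn); apply: val_inj.
Qed.

Definition delta n : 'S_n := perm (@rev_ord_inj n).

Definition delta_part n (P : {set {set 'I_n}}) : {set {set 'I_n}} :=
  [set delta n @: B | B : {set 'I_n} in P].

Definition S_part n (P : {set {set 'I_n}}) : {set 'S_n} :=
  [set s : 'S_n | [forall B in P, s @: B == B]].

Definition involves m n (s : 'S_m) (t : 'S_n) : bool :=
  [exists f : {ffun 'I_n -> 'I_m},
     [forall j : 'I_n, forall k : 'I_n, (j < k) ==> (f j < f k)]
     && [forall j : 'I_n, forall k : 'I_n,
           (s (f j) < s (f k)) == (t j < t k)]].

Definition Comp m n (S : {set 'S_n}) : {set 'S_m} :=
  [set s : 'S_m | [forall t : 'S_n, involves s t ==> (t \in S)]].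

(* Main.v *)
(* Call k a cut when k and k+1 lie in different blocks of Pi.  The blocks of the
   interval partition are the runs between cuts, and Pi' cuts [n+1] further, so
   that k+1 becomes a singleton separating {1, ..., k} from {k+2, ..., n+1} for
   every cut k.  Deleting a point of a permutation preserving Pi' therefore gives
   one preserving the interval partition, hence Pi.  Conversely, let all
   deletions of s preserve Pi and let k be a cut.  Comparing the deletions of two
   consecutive positions i and i+1 shows that the values of s cannot jump there
   from below k+1 to above k+1 or back.  As k+1 is taken only once, the values
   below it fill one side of its position and those above it the other side: s
   respects the cut k either directly or after reversal.  The orientation is the
   same for all cuts, so s or its reversal preserves Pi'; in the second case a
   deletion of s is the reversal of a permutation in S_Pi, so delta_n is in S_Pi. *)
Require Import Defs.
From mathcomp Require Import all_boot all_fingroup.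
From mathcomp Require Import zify.

Set Implicit Arguments.
Unset Strict Implicit.
Unset Printing Implicit Defensive.

Local Open Scope group_scope.

(** * Blocks of coarsest partitions, meets and one-point extensions *)

Section Blocks.
Variable T : finType.
Implicit Types P Q : {set {set T}}.

Lemma eq_pblockT Q x y : partition Q [set: T] ->
  (pblock Q x == pblock Q y) = (y \in pblock Q x).
Proof. by case/and3P=> /eqP cQ tQ _; rewrite eq_pblock // cQ. Qed.

Lemma partition_blockE Q B : partition Q [set: T] -> B \in Q ->
  exists x, B = pblock Q x.
Proof.
move=> pQ QB; have [x Bx] := set0Pn _ (partition_neq0 pQ QB).
by exists x; case/and3P: pQ => _ tQ _; rewrite (def_pblock tQ QB Bx).
Qed.

(** Maximality in usable form: the classes of [r] form a good partition, which therefore refines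
    [Q]. *)
Lemma coarsest_same good Q (r : rel T) x y : is_coarsest good Q ->
  equivalence_rel r -> good (equivalence_partition r [set: T]) -> r x y ->
  pblock Q x = pblock Q y.
Proof.
move=> /and3P[pQ _ /forallP maxQ] eqr gr rxy.
have eqr' : {in [set: T] & &, equivalence_rel r} by move=> ? ? ? _ _ _; apply: eqr.
have pr := equivalence_partitionP eqr'.
have /implyP := maxQ (equivalence_partition r [set: T]); rewrite pr gr => /(_ isT) rQ.
apply: (refines_same rQ pQ (pblock_memT x pr)); first exact: mem_pblockT.
by rewrite pblock_equivalence_partition ?inE.
Qed.

Lemma meet_same P1 P2 x y :
  partition P1 [set: T] -> partition P2 [set: T] ->
  (pblock (meet P1 P2) x == pblock (meet P1 P2) y)
    = (pblock P1 x == pblock P1 y) && (pblock P2 x == pblock P2 y).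
Proof.
move=> pP1 pP2; have cM := meetP pP1 pP2.
have /and3P[pM /andP[r1 r2] _] := cM.
apply/idP/idP => [|/andP[e1 e2]].
  rewrite eq_pblockT // => yx.
  have xx := mem_pblockT x pM; have Mx := pblock_memT x pM.
  by rewrite (refines_same r1 pP1 Mx xx yx) (refines_same r2 pP2 Mx xx yx) !eqxx.
pose r x y := (pblock P1 x == pblock P1 y) && (pblock P2 x == pblock P2 y).
have eqr : equivalence_rel r.
  by move=> u v w; split=> [|/andP[/eqP E1 /eqP E2]]; rewrite /r ?eqxx // E1 E2.
apply/eqP/(coarsest_same cM eqr); last by rewrite /r e1.
apply/andP; split; apply/refinesP=> B /imsetP[u _ ->].
  exists (pblock P1 u); first exact: pblock_memT.
  by apply/subsetP=> v; rewrite !inE -eq_pblockT // => /=/andP[].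
exists (pblock P2 u); first exact: pblock_memT.
by apply/subsetP=> v; rewrite !inE -eq_pblockT // => /=/andP[].
Qed.

End Blocks.

(** Common to [add_first] and [add_last]: since [g] undoes [h] and sends the new point [b] to [a],
    the blocks of [E] are the preimages under [g] of the blocks of [Q]. *)
Lemma extend_same (T T' : finType) (h : T -> T') (g : T' -> T) (a : T) (b : T')
    (Q : {set {set T}}) y z :
  cancel h g -> g b = a -> (forall x, h x != b) ->
  (forall y, y != b -> exists x, y = h x) -> partition Q [set: T] ->
  let E := [set h @: B | B : {set T} in Q & a \notin B]
           :|: [set h @: pblock Q a :|: [set b]] in
  (pblock E y == pblock E z) = (pblock Q (g y) == pblock Q (g z)).
Proof.
move=> hK gb hb hS pQ E.
have pE : partition E [set: T'] by apply: partition_extend => //; apply: can_inj hK.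
have tQ : trivIset Q by case/and3P: pQ.
have mem_h (B : {set T}) x : (h x \in h @: B) = (x \in B).
  by rewrite mem_imset //; apply: can_inj hK.
have bN (B : {set T}) : b \in h @: B = false.
  by apply/imsetP=> -[x _ /esym/eqP]; rewrite (negbTE (hb x)).
suff EB : g @^-1: pblock Q (g y) \in E.
  have tE : trivIset E by case/and3P: pE.
  rewrite (eq_pblockT _ _ pE) (eq_pblockT _ _ pQ).
  by rewrite (def_pblock tE EB) ?inE ?mem_pblockT.
have [ay|nay] := boolP (a \in pblock Q (g y)).
  rewrite !inE; apply/orP; right; apply/eqP/setP=> u; rewrite !inE.
  rewrite -(same_pblock tQ ay).
  have [->|/hS[x ->]] := eqVneq u b; first by rewrite gb mem_pblockT // orbT.
  by rewrite hK mem_h orbF.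
rewrite !inE; apply/orP; left; apply/imsetP.
exists (pblock Q (g y)); first by rewrite inE pblock_memT.
apply/setP=> u; rewrite inE.
have [->|/hS[x ->]] := eqVneq u b; first by rewrite gb bN; apply: negbTE.
by rewrite hK mem_h.
Qed.

(** * Block-preserving permutations, the reversal and cuts *)

Lemma S_partP n (Q : {set {set 'I_n}}) (s : 'S_n) : partition Q [set: 'I_n] ->
  reflect (forall x, pblock Q (s x) = pblock Q x) (s \in S_part Q).
Proof.
move=> pQ; rewrite inE; apply: (iffP forall_inP) => [sQ x|sQ B QB].
  apply/esym/eqP; rewrite eq_pblockT //.
  by rewrite -(eqP (sQ _ (pblock_memT x pQ))) imset_f // mem_pblockT.
rewrite eqEcard (card_imset _ (@perm_inj _ s)) leqnn andbT.
have [x ->] := partition_blockE pQ QB.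
apply/subsetP=> _ /imsetP[y yx ->].
by rewrite -eq_pblockT // sQ eq_pblockT.
Qed.

Lemma S_part_group_set n (Q : {set {set 'I_n}}) : partition Q [set: 'I_n] ->
  group_set (S_part Q).
Proof.
move=> pQ; apply/group_setP; split; first by apply/S_partP=> // x; rewrite perm1.
move=> s t /(S_partP _ pQ) sQ /(S_partP _ pQ) tQ; apply/S_partP=> // x.
by rewrite permM tQ sQ.
Qed.

Lemma deltaE n (x : 'I_n) : delta n x = n - x.+1 :> nat.
Proof. by rewrite permE. Qed.

Lemma deltaK n : involutive (delta n).
Proof. by move=> x; rewrite !permE rev_ordK. Qed.

Lemma deltaM n : delta n * delta n = 1.
Proof. by apply/permP=> x; rewrite permM deltaK perm1. Qed.

(* [k] counts from 0: the cut lies between the ordinals [k] and [k.+1]. *)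
Definition cut n (P : {set {set 'I_n.+1}}) (k : nat) : bool :=
  (k < n) && (pblock P (inord k) != pblock P (inord k.+1)).

(** A block of [hat P] is an interval inside a block of [P], so it straddles no cut. Conversely,
    lying on the same side of every cut is an equivalence whose classes are such intervals, and
    [hat P] is coarsest. *)
Lemma hat_same n (P : {set {set 'I_n.+1}}) (x y : 'I_n.+1) :
  partition P [set: 'I_n.+1] ->
  reflect (forall k, cut P k -> (x <= k) = (y <= k))
          (pblock (hat P) x == pblock (hat P) y).
Proof.
move=> pP; have cH := hatP pP; have /and3P[pH /andP[iH rH] _] := cH.
apply: (iffP idP) => [xy k|xy].
  case/andP=> ltkn; apply: contraNeq => neq.
  have Hx := pblock_memT x pH; have xx := mem_pblockT x pH.
  have yx : y \in pblock (hat P) x by rewrite -eq_pblockT.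
  have iB := forall_inP iH _ Hx.
  have inB (u v w : 'I_n.+1) : u \in pblock (hat P) x -> v \in pblock (hat P) x ->
      u <= w <= v -> w \in pblock (hat P) x.
    by move=> ux vx uwv; apply: (implyP (forallP (forall_inP (forall_inP iB _ ux) _ vx) w)).
  apply/eqP/(refines_same rH pP Hx).
    by case: (leqP x y) => ?; [apply: (inB x y)|apply: (inB y x)]; rewrite // inordK; lia.
  by case: (leqP x y) => ?; [apply: (inB x y)|apply: (inB y x)]; rewrite // inordK; lia.
pose r (x y : 'I_n.+1) := [forall k : 'I_n, cut P k ==> ((x <= k) == (y <= k))].
have rP (u v : 'I_n.+1) : reflect (forall k, cut P k -> (u <= k) = (v <= k)) (r u v).
  apply: (iffP forallP) => h k; last by apply/implyP=> /h->.
  move=> ck; have ltkn : k < n by case/andP: ck.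
  by have /implyP/(_ ck)/eqP := h (Ordinal ltkn).
have eqr : equivalence_rel r.
  move=> u v w; split=> [|/rP uv]; first by apply/rP.
  by apply/rP/rP=> h k ck; rewrite -h // uv.
(* Walk from [u] up to [v] one point at a time: a change of block would be a cut separating them. *)
have same_le d (u v : 'I_n.+1) : v = u + d :> nat -> r u v -> pblock P u = pblock P v.
  elim: d v => [|d IHd] v vud /rP ruv.
    by congr pblock; apply: val_inj; rewrite /= vud addn0.
  have ltud : u + d < n by have := ltn_ord v; lia.
  have <- : pblock P (inord (u + d)) = pblock P v.
    have -> : v = inord (u + d).+1 by apply: val_inj; rewrite /= inordK; lia.
    apply: contraTeq isT => neq.
    have ck : cut P (u + d) by rewrite /cut ltud.
    by have := ruv _ ck; rewrite vud; lia.
  apply: IHd; first by rewrite inordK; lia.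
  by apply/rP=> k ck; have := ruv k ck; rewrite inordK; lia.
apply/eqP/(coarsest_same cH eqr); last exact/rP.
apply/andP; split.
  apply/forall_inP=> _ /imsetP[u _ ->].
  apply/forall_inP=> i; rewrite !inE => /rP ui.
  apply/forall_inP=> k; rewrite !inE => /rP uk.
  apply/forallP=> j; apply/implyP=> ijk; rewrite !inE.
  by apply/rP=> l cl; have := ui l cl; have := uk l cl; lia.
apply/refinesP=> _ /imsetP[u _ ->]; exists (pblock P u); first exact: pblock_memT.
apply/subsetP=> v; rewrite !inE => ruv; rewrite -eq_pblockT //; apply/eqP.
case: (leqP u v) => uv; first by apply: (same_le (v - u)) => //; lia.
apply/esym/(same_le (u - v)); first by lia.
by apply/rP=> k ck; rewrite (rP _ _ ruv).
Qed.

(** * The refined partition and the groups, in terms of cuts *)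

Section Prime.
Variables (n : nat) (P : {set {set 'I_n.+1}}).
Hypothesis pP : partition P [set: 'I_n.+1].

Let pH : partition (hat P) [set: 'I_n.+1].
Proof. by case/and3P: (hatP pP). Qed.

Lemma prime_partition : partition (prime_part P) [set: 'I_n.+2].
Proof. by case/and3P: (prime_partP pP). Qed.

Let lift0_neq (x : 'I_n.+1) : lift ord0 x != ord0.
Proof. by []. Qed.

Let lift0_onto (y : 'I_n.+2) : y != ord0 -> exists x, y = lift ord0 x.
Proof. by rewrite eq_sym => /unlift_some[x ->]; exists x. Qed.

Let widen_neq (x : 'I_n.+1) : widen_ord (leqnSn n.+1) x != ord_max.
Proof. by rewrite -val_eqE /=; have := ltn_ord x; lia. Qed.

Let widen_onto (y : 'I_n.+2) : y != ord_max ->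
  exists x, y = widen_ord (leqnSn n.+1) x.
Proof.
rewrite -val_eqE /= => ny; have yn : y < n.+1 by have := ltn_ord y; lia.
by exists (Ordinal yn); apply: val_inj.
Qed.

Lemma prime_same (x y : 'I_n.+2) :
  reflect (forall k, cut P k -> (x <= k) = (y <= k) /\ (x <= k.+1) = (y <= k.+1))
          (pblock (prime_part P) x == pblock (prime_part P) y).
Proof.
(* [g0] merges the two least points, [g1] the two greatest. For a cut [k < n], [g0 x <= k] means
   [x <= k.+1] and [g1 x <= k] means [x <= k]. *)
pose g0 (y : 'I_n.+2) : 'I_n.+1 := inord y.-1.
pose g1 (y : 'I_n.+2) : 'I_n.+1 := inord (minn y n).
have g0E (z : 'I_n.+2) : g0 z = z.-1 :> nat by rewrite inordK; have := ltn_ord z; lia.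
have g1E (z : 'I_n.+2) : g1 z = minn z n :> nat by rewrite inordK; lia.
have g0K : cancel (lift ord0) g0 by move=> z; apply: val_inj; rewrite /= g0E.
have g1K : cancel (widen_ord (leqnSn n.+1)) g1.
  by move=> z; apply: val_inj; rewrite /= g1E /=; have := ltn_ord z; lia.
have g00 : g0 ord0 = ord0 by apply: val_inj; rewrite /= g0E.
have g1m : g1 ord_max = ord_max by apply: val_inj; rewrite /= g1E /=; lia.
rewrite meet_same; first last.
- by apply: partition_extend => //; apply: can_inj g1K.
- by apply: partition_extend => //; apply: can_inj g0K.
rewrite (extend_same x y g0K g00 lift0_neq lift0_onto pH).
rewrite (extend_same x y g1K g1m widen_neq widen_onto pH).
have cn k : cut P k -> k < n by case/andP.
apply: (iffP andP) => [[/hat_same-/(_ pP) h0 /hat_same-/(_ pP) h1] k ck|h].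
  by have := h0 k ck; have := h1 k ck; have := cn k ck; rewrite !g0E !g1E; lia.
by split; apply/hat_same=> // k ck; have := h k ck; have := cn k ck;
  rewrite ?g0E ?g1E; lia.
Qed.

Lemma S_primeP (s : 'S_n.+2) :
  reflect (forall k x, cut P k -> (s x <= k) = (x <= k) /\ (s x <= k.+1) = (x <= k.+1))
          (s \in S_part (prime_part P)).
Proof.
apply: (iffP (S_partP _ prime_partition)) => h.
  by move=> k x; apply/prime_same/eqP/h.
by move=> x; apply/eqP/prime_same=> k; apply: h.
Qed.

Lemma S_hatP (s : 'S_n.+1) :
  reflect (forall k x, cut P k -> (s x <= k) = (x <= k)) (s \in S_part (hat P)).
Proof.
apply: (iffP (S_partP _ pH)) => h; first by move=> k x; apply/hat_same/eqP/h.
by move=> x; apply/eqP/hat_same=> // k; apply: h.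
Qed.

Lemma S_hat_sub : S_part (hat P) \subset S_part P.
Proof.
apply/subsetP=> s /(S_partP _ pH) sH; apply/S_partP=> // x.
have /and3P[_ /andP[_ rH] _] := hatP pP.
apply: (refines_same rH pP (pblock_memT (s x) pH)); first exact: mem_pblockT.
by rewrite sH mem_pblockT.
Qed.

End Prime.

(** * Patterns with one point fewer as deletions *)

Lemma ord_mono_id m (g : 'I_m -> 'I_m) :
  (forall j k : 'I_m, j < k -> g j < g k) -> g =1 id.
Proof.
move=> mono.
have ge d (j : 'I_m) : j = d :> nat -> d <= g j.
  elim: d j => // d IHd j jd; have ltdm : d < m by have := ltn_ord j; lia.
  have := IHd (Ordinal ltdm) erefl; have := mono (Ordinal ltdm) j.
  by rewrite /= jd; lia.
have le d (j : 'I_m) : m - j.+1 = d -> g j <= j.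
  elim: d j => [|d IHd] j jd; first by have := ltn_ord (g j); have := ltn_ord j; lia.
  have ltjm : j.+1 < m by lia.
  have := IHd (Ordinal ltjm); have := mono j (Ordinal ltjm); rewrite /=; lia.
by move=> j; apply: val_inj; apply/eqP; rewrite eqn_leq (le _ _ erefl) (ge _ _ erefl).
Qed.

(** Position [i] and its value are erased; [lift] skips the erased position or value, which encodes
    the relabelling of the rest. *)
Definition deletes m (i : 'I_m.+1) (s : 'S_m.+1) (t : 'S_m) : Prop :=
  forall j, lift (s i) (t j) = s (lift i j).

Lemma lift_lt m (a : 'I_m.+1) (j k : 'I_m) : (lift a j < lift a k) = (j < k).
Proof. by rewrite /= /bump; lia. Qed.

Lemma lift_factor m (a : 'I_m.+1) (f : 'I_m -> 'I_m.+1) :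
  (forall j, a != f j) -> exists g, forall j, lift a (g j) = f j.
Proof.
move=> aN; have h j : {y | lift a y = f j}.
  by have [y -> _] := unlift_some (aN j); exists y.
by exists (fun j => sval (h j)) => j; apply: (svalP (h j)).
Qed.

Lemma deletes_exists m (i : 'I_m.+1) (s : 'S_m.+1) : exists t, deletes i s t.
Proof.
have [j|g gE] := @lift_factor m (s i) (fun j => s (lift i j)).
  by rewrite (inj_eq perm_inj) neq_lift.
have inj : injective g.
  by move=> j k /(congr1 (lift (s i))); rewrite !gE => /perm_inj/lift_inj.
by exists (perm inj) => j; rewrite permE gE.
Qed.

(** An increasing map into a set with one more point misses some [i], hence is [lift i]. *)
Lemma involvesP m (s : 'S_m.+1) (t : 'S_m) :
  reflect (exists i, deletes i s t) (involves s t).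
Proof.
apply: (iffP existsP) => [[f /andP[/forallP fmono /forallP fst]]|[i ist]]; last first.
  exists [ffun j => lift i j]; apply/andP; split; apply/forallP=> j;
    apply/forallP=> k; rewrite !ffunE.
    by rewrite lift_lt; apply/implyP.
  by rewrite -!ist lift_lt.
have [i iN] : exists i, i \notin codom f.
  apply/existsP; rewrite -negb_forall; apply/negP=> /forallP all_f.
  have := leq_image_card f predT.
  have -> : #|codom f| = m.+1 by rewrite -[RHS]card_ord; apply: eq_card => z; rewrite all_f.
  by rewrite card_ord ltnn.
have fN j : i != f j by apply: contraNneq iN => ->; apply: codom_f.
exists i.
have [g gE] := lift_factor fN.
have g_id : g =1 id.
  by apply: ord_mono_id => j k; rewrite -(lift_lt i (g j)) !gE; have /forallP/(_ k)/implyP := fmono j.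
have fE j : f j = lift i j by rewrite -gE g_id.
have [j|u uE] := @lift_factor m (s i) (fun j => s (lift i j)).
  by rewrite (inj_eq perm_inj) neq_lift.
(* [t] and the actual deletion [u] order the positions alike, so [u] after [t^-1] is increasing. *)
have ut : (fun j => u (t^-1 j)) =1 id.
  apply: ord_mono_id => j k jk; rewrite -(lift_lt (s i) (u _)) !uE -!fE.
  by have /forallP/(_ (t^-1 k))/eqP-> := fst (t^-1 j); rewrite !permKV.
by move=> j; rewrite -uE -(ut (t j)) permK.
Qed.

Lemma CompP m (S : {set 'S_m}) (s : 'S_m.+1) :
  reflect (forall i t, deletes i s t -> t \in S) (s \in Comp m.+1 S).
Proof.
rewrite inE; apply: (iffP forallP) => [h i t ist|h t].
  by apply: (implyP (h t)); apply/involvesP; exists i.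
by apply/implyP=> /involvesP[i]; apply: h.
Qed.

(** A product applies its left factor first: a right factor [delta] reverses values and keeps the
    erased position, while a left factor mirrors positions. *)
Lemma deletes_delta m (i : 'I_m.+1) (s : 'S_m.+1) (t : 'S_m) :
  deletes i s t -> deletes i (s * delta m.+1) (t * delta m).
Proof.
move=> h j; have := congr1 val (h j); rewrite !permM => e.
apply: val_inj; move: e; rewrite /= !deltaE /bump /=.
by have := ltn_ord (t j); have := ltn_ord (s i); lia.
Qed.

Lemma deletes_deltaL m (i : 'I_m.+1) (s : 'S_m.+1) (t : 'S_m) :
  deletes i s t -> deletes (delta m.+1 i) (delta m.+1 * s) (delta m * t).
Proof.
move=> h j; rewrite !permM deltaK h; congr (s _); apply: val_inj.
rewrite /= !deltaE /= !deltaE /bump.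
by have := ltn_ord i; have := ltn_ord j; lia.
Qed.

(** Counting: [s] carries the first [p] positions onto the [k] least values. *)
Lemma perm_initial m (s : 'S_m) k p : k < m -> p <= m ->
  (forall q, (s q < k) = (q < p)) -> p = k.
Proof.
have cE r : r <= m -> #|[set x : 'I_m | x < r]| = r.
  move=> lerm; have winj : injective (widen_ord lerm).
    by move=> x y /(congr1 val) /= /val_inj.
  rewrite -[RHS]card_ord -(card_imset _ winj).
  apply: eq_card => x; rewrite !inE; apply/idP/imsetP => [ltxr|[y _ ->]] //=.
  by exists (Ordinal ltxr) => //; apply: val_inj.
move=> ltkm lepm h; rewrite -(cE k (ltnW ltkm)) -{1}(cE p lepm).
rewrite -(card_imset _ (@perm_inj _ s)); apply: eq_card => x; rewrite !inE.
by apply/imsetP/idP => [[q]|xk]; [|exists (s^-1 x)]; rewrite ?inE -?h ?permKV // => ? ->.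
Qed.

(** * Permutations all of whose deletions preserve the partition *)

Section Main.
Variables (n : nat) (P : {set {set 'I_n.+1}}).
Hypothesis pP : partition P [set: 'I_n.+1].

(** Position [i] and value [s i] are both below, both equal to or both above [k.+1], so erasing them
    shifts the boundary equally for positions and values. *)
Lemma deletes_prime_hat i (s : 'S_n.+2) (t : 'S_n.+1) : deletes i s t ->
  s \in S_part (prime_part P) -> t \in S_part (hat P).
Proof.
move=> ist /(S_primeP pP) sP; apply/(S_hatP pP) => k j ck.
have := sP k i ck; have := sP k (lift i j) ck; have := congr1 val (ist j).
by rewrite /= /bump; lia.
Qed.

Lemma S_prime_Comp : S_part (prime_part P) \subset Comp n.+2 (S_part P).
Proof.
apply/subsetP=> s sP; apply/CompP=> i t ist.
exact: (subsetP (S_hat_sub pP)) (deletes_prime_hat ist sP).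
Qed.

(** Each point shares its block with its mirror image. *)
Lemma cut_sym k : delta n.+1 \in S_part P -> cut P k -> cut P (n - k.+1).
Proof.
move=> /(S_partP _ pP) dP /andP[ltkn neq]; apply/andP; split; first by lia.
have dE (j : nat) : j <= n -> pblock P (inord (n - j)) = pblock P (inord j).
  move=> lejn; rewrite -[RHS]dP; congr pblock; apply: val_inj.
  by rewrite /= deltaE !inordK; lia.
rewrite dE //; have -> : (n - k.+1).+1 = n - k by lia.
by rewrite dE 1?eq_sym //; lia.
Qed.

(* The common position [j] of the value [k.+1] in the two deletions carries
   [k] in one and [k.+1] in the other. *)
Lemma Comp_no_jump (s : 'S_n.+2) k (p q : 'I_n.+2) :
  s \in Comp n.+2 (S_part P) -> cut P k -> (q = p.+1 :> nat) \/ (p = q.+1 :> nat) ->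
  s p <= k -> s q <= k.+1.
Proof.
move=> /CompP sC /andP[ltkn neq] pq spk; rewrite leqNgt; apply/negP=> sqk.
have ltk1 : k.+1 < n.+2 by lia.
pose v : 'I_n.+2 := Ordinal ltk1; pose r := s^-1 v.
have sr : s r = v by rewrite permKV.
have rp : r <> p :> nat by move/val_inj=> e; move: spk; rewrite -e sr /=; lia.
have rq : r <> q :> nat by move/val_inj=> e; move: sqk; rewrite -e sr /=; lia.
(* [r] differs from the adjacent positions [p] and [q], so it lies on the same side of both and gets
   the same index [j] after either deletion. *)
pose j : 'I_n.+1 := inord (if p < r then r.-1 else r).
have jE : j = (if p < r then r.-1 else r) :> nat.
  rewrite inordK //; have := ltn_ord r; have := ltn_ord p.
  by case: (ltnP p r) rp; lia.
have jp : lift p j = r.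
  by apply: val_inj; rewrite /= /bump jE; case: (ltnP p r) rp; lia.
have jq : lift q j = r.
  by apply: val_inj; rewrite /= /bump jE; case: (ltnP p r) pq rp rq; lia.
have [t pt] := deletes_exists p s; have [u qu] := deletes_exists q s.
have /(S_partP _ pP)/(_ j) tj := sC p t pt.
have /(S_partP _ pP)/(_ j) uj := sC q u qu.
have := congr1 val (pt j); have := congr1 val (qu j).
rewrite jp jq sr /= /bump => ujE tjE.
move: neq; have -> : inord k = t j by apply: val_inj; rewrite /= inordK; lia.
have -> : inord k.+1 = u j by apply: val_inj; rewrite /= inordK; lia.
by rewrite tj uj eqxx.
Qed.

Definition increasing_at (s : 'S_n.+2) k : Prop :=
  forall x, (s x <= k) = (x <= k) /\ (s x <= k.+1) = (x <= k.+1).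

(** Counting forces [r = k.+1]; the second boundary follows because the value [k.+1] occurs only at
    [r]. *)
Lemma initial_increasing (s : 'S_n.+2) k r : k < n -> s r = k.+1 :> nat ->
  (forall q, (s q <= k) = (q < r)) -> increasing_at s k.
Proof.
move=> ltkn sr h.
have rE : r = k.+1 :> nat.
  by apply: (@perm_initial _ s) => //; [lia|exact: ltnW (ltn_ord r)].
move=> x; have hx := h x; split; first by rewrite hx rE.
have [->|neq] := eqVneq x r; first by rewrite sr rE.
have : s x != s r by rewrite (inj_eq perm_inj).
by move: neq; rewrite -!val_eqE /=; lia.
Qed.

(** The condition at [k] gives [s ord0 < s ord_max], the one at [l] the opposite. Thus all cuts
    share one orientation. *)
Lemma increasing_not_both (s : 'S_n.+2) k l : k < n -> l < n ->
  increasing_at s k -> increasing_at (delta n.+2 * s) l -> False.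
Proof.
move=> ltkn ltln inc dec.
have d0 : delta n.+2 ord0 = ord_max by apply: val_inj; rewrite /= deltaE subn1.
have dm : delta n.+2 ord_max = ord0 by rewrite -d0 deltaK.
have := inc ord0; have := inc ord_max; have := dec ord0; have := dec ord_max.
by rewrite !permM d0 dm /=; lia.
Qed.

(* The values of [s] cannot cross the level [k.+1] except at its position [p],
   so they stay on one side of it before [p] and on the other side after. *)
Lemma Comp_cut (s : 'S_n.+2) k : s \in Comp n.+2 (S_part P) -> cut P k ->
  increasing_at s k \/ increasing_at (delta n.+2 * s) k.
Proof.
move=> sC ck; have ltkn : k < n by case/andP: ck.
pose p := s^-1 (inord k.+1).
have sp : s p = k.+1 :> nat by rewrite permKV inordK; lia.
have sN q : q <> p -> s q <> k.+1 :> nat.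
  by move=> neq; rewrite -sp => /val_inj/perm_inj.
have step (q q' : 'I_n.+2) : q' = q.+1 :> nat -> q <> p -> q' <> p ->
    (s q <= k) = (s q' <= k).
  move=> qq' /sN qN /sN q'N; apply/idP/idP => le.
    have := Comp_no_jump sC ck (or_introl qq') le; lia.
  by have := Comp_no_jump sC ck (or_intror qq') le; lia.
have const d (q q' : 'I_n.+2) : q' = q + d :> nat -> p < q \/ q' < p ->
    (s q <= k) = (s q' <= k).
  elim: d q' => [|d IHd] q' qq' side.
    by congr (s _ <= _); apply: val_inj; rewrite /= qq' addn0.
  have ltr : q + d < n.+2 by have := ltn_ord q'; lia.
  rewrite (IHd (Ordinal ltr)) //=; last by lia.
  by apply: step; [rewrite /=; lia| |]; move/(congr1 val) => /=; lia.
have side (q q' : 'I_n.+2) : (q < p /\ q' < p) \/ (p < q /\ p < q') -> (s q <= k) = (s q' <= k).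
  move=> h; case: (leqP q q') => qq'; first by apply: (const (q' - q)); lia.
  by apply/esym/(const (q - q')); lia.
(* [a] and [b] carry values below and above [k.+1], so [side] puts them on opposite sides of [p];
   which side holds [a] decides the orientation. *)
pose a := s^-1 ord0; pose b := s^-1 (inord k.+2).
have sa : s a = 0 :> nat by rewrite permKV.
have sb : s b = k.+2 :> nat by rewrite permKV inordK; lia.
have ap : a <> p :> nat by move/val_inj=> e; move: sa; rewrite e sp.
have bp : b <> p :> nat by move/val_inj=> e; move: sb; rewrite e sp; lia.
have [lt_ap|le_pa] := ltnP a p.
  left; apply: (@initial_increasing _ _ p) => // q.
  have := side a b; have := side a q; have := side b q.
  have [->|/eqP qp] := eqVneq q p; first by rewrite sp; lia.
  have {}qp : q <> p :> nat by move/val_inj.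
  by rewrite sa sb; lia.
right; apply: (@initial_increasing _ _ (delta n.+2 p)) => // [|q].
  by rewrite permM deltaK.
rewrite permM; set q' := delta n.+2 q.
have -> : (q < delta n.+2 p) = (p < q').
  by rewrite !deltaE; have := ltn_ord q; have := ltn_ord p; lia.
have := side a b; have := side a q'; have := side b q'.
have [->|/eqP qp] := eqVneq q' p; first by rewrite sp; lia.
have {}qp : q' <> p :> nat by move/val_inj.
by rewrite sa sb; lia.
Qed.

Lemma Comp_prime (s : 'S_n.+2) : s \in Comp n.+2 (S_part P) ->
  s \in S_part (prime_part P) \/ delta n.+2 * s \in S_part (prime_part P).
Proof.
move=> sC; have [|sN] := boolP (s \in S_part (prime_part P)); first by left.
right; apply/(S_primeP pP) => k x ck.
have [inc|] := Comp_cut sC ck; last exact.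
(* As [s] is direct at [k], no cut [l] can be reversed, so [s] would preserve [prime_part P]. *)
case/negP: sN; apply/(S_primeP pP) => l y cl.
have [|dec] := Comp_cut sC cl; first exact.
by case: (increasing_not_both _ _ inc dec); [case/andP: ck|case/andP: cl].
Qed.

Lemma Comp_no_delta : delta n.+1 \notin S_part P ->
  Comp n.+2 (S_part P) = S_part (prime_part P).
Proof.
move=> dN; apply/eqP; rewrite eqEsubset S_prime_Comp andbT.
apply/subsetP=> s sC; have [//|dsP] := Comp_prime sC.
(* Any deletion will do: [t] and [delta n.+1 * t] both lie in the group [S_part P], hence so would
   [delta n.+1]. *)
have [t st] := deletes_exists ord0 s.
have dtP := subsetP (S_hat_sub pP) _ (deletes_prime_hat (deletes_deltaL st) dsP).
have tP := (CompP _ _ sC) _ _ st.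
case/negP: dN; pose G := Group (S_part_group_set pP).
by rewrite -(groupMr _ (tP : t \in G)).
Qed.

(** Reversal turns the two conditions at [k] into those at the mirrored cut [n - k.+1],
    interchanged. *)
Lemma prime_delta_same x y : delta n.+1 \in S_part P ->
  pblock (prime_part P) x == pblock (prime_part P) y ->
  pblock (prime_part P) (delta n.+2 x) == pblock (prime_part P) (delta n.+2 y).
Proof.
move=> dP /(prime_same pP) xy; apply/(prime_same pP) => k ck.
have ltkn : k < n by case/andP: ck.
have := xy _ (cut_sym dP ck); rewrite !deltaE.
by have := ltn_ord x; have := ltn_ord y; lia.
Qed.

Lemma prime_deltaE : delta n.+1 \in S_part P ->
  prime_part P = delta_part (prime_part P).
Proof.
move=> dP; have pQ := prime_partition pP.
apply/esym/eqP; rewrite eqEcard card_imset ?leqnn ?andbT; last first.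
  exact: imset_inj (@perm_inj _ _).
apply/subsetP=> _ /imsetP[B QB ->]; have [x ->] := partition_blockE pQ QB.
suff -> : delta n.+2 @: pblock (prime_part P) x = pblock (prime_part P) (delta n.+2 x).
  exact: pblock_memT.
apply/setP=> y; rewrite -eq_pblockT //; apply/imsetP/idP => [[z]|xy].
  by rewrite -eq_pblockT // => xz ->; apply: prime_delta_same.
exists (delta n.+2 y); last by rewrite deltaK.
by rewrite -eq_pblockT // -[x](@deltaK n.+2); apply: prime_delta_same.
Qed.

(** This turns the left coset coming from [Comp_prime] into a right coset, and makes the join with
    the subgroup generated by [delta n.+2] a product. *)
Lemma prime_delta_norm : delta n.+1 \in S_part P ->
  delta n.+2 \in 'N(S_part (prime_part P)).
Proof.
move=> dP; have pQ := prime_partition pP.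
rewrite inE; apply/subsetP=> _ /imsetP[s /(S_partP _ pQ) sQ ->].
apply/(S_partP _ pQ) => x; rewrite -[x](permKV (delta n.+2)) permJ.
by apply/eqP/prime_delta_same => //; apply/eqP/sQ.
Qed.

Lemma Comp_delta : delta n.+1 \in S_part P ->
  Comp n.+2 (S_part P)
    = S_part (prime_part P) :|: S_part (prime_part P) :* delta n.+2.
Proof.
move=> dP; apply/eqP; rewrite eqEsubset; apply/andP; split.
  apply/subsetP=> s /Comp_prime[sP|dsP]; rewrite inE ?sP //.
  pose G := Group (S_part_group_set (prime_partition pP)).
  apply/orP; right; rewrite (@norm_rlcoset _ G _ (prime_delta_norm dP)).
  by apply/lcosetP; exists (delta n.+2 * s); rewrite // mulgA deltaM mul1g.
apply/subsetP=> s /setUP[|/rcosetP[{}s sP ->]].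
  exact: (subsetP S_prime_Comp).
(* Reversing values makes [t * delta n.+1] a deletion of [s], hence an element of the group
   [S_part P]; so [t] is one too. *)
apply/CompP=> i t /deletes_delta; rewrite -mulgA deltaM mulg1 => st.
have tP := subsetP (S_hat_sub pP) _ (deletes_prime_hat st sP).
pose G := Group (S_part_group_set pP).
by rewrite -(groupMr _ (dP : delta n.+1 \in G)).
Qed.

Lemma prime_delta_gen : delta n.+1 \in S_part P ->
  S_part (prime_part P) :|: S_part (prime_part P) :* delta n.+2
    = <<S_part (prime_part P) :|: [set delta n.+2]>>.
Proof.
move=> dP; pose G := Group (S_part_group_set (prime_partition pP)).
have nGd : <[delta n.+2]> \subset 'N(G) by rewrite cycle_subG prime_delta_norm.
have -> : <<S_part (prime_part P) :|: [set delta n.+2]>> = G <*> <[delta n.+2]>.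
  by rewrite joing_idr.
rewrite norm_joinEr //.
apply/setP=> s; apply/setUP/mulsgP => [[sP|/rcosetP[g gP ->]]|[g d gP]].
- by exists s 1; rewrite ?group1 ?mulg1.
- by exists g (delta n.+2); rewrite ?cycle_id.
(* [delta n.+2] is an involution, so only the parity of the exponent matters. *)
case/cycleP=> k -> ->; rewrite -(odd_double_half k) expgD -mul2n expgM.
have -> : delta n.+2 ^+ 2 = 1 by rewrite expgS expg1 deltaM.
rewrite expg1n mulg1; case: (odd k); last by left; rewrite mulg1.
by right; apply/rcosetP; exists g.
Qed.

End Main.

(* (s * t) x = t (s x) for permutations, so the set of right-to-left composites
   of delta with the elements of S is S :* delta. *)
Theorem theorem4p7 (n : nat) (P : {set {set 'I_n.+1}})
    (hP : partition P [set: 'I_n.+1]) :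
  (delta n.+1 \notin S_part P ->
     Comp n.+2 (S_part P) = S_part (prime_part P))
  /\
  (delta n.+1 \in S_part P ->
     [/\ Comp n.+2 (S_part P)
           = S_part (prime_part P) :|: S_part (prime_part P) :* delta n.+2,
         S_part (prime_part P) :|: S_part (prime_part P) :* delta n.+2
           = <<S_part (prime_part P) :|: [set delta n.+2]>>
       & prime_part P = delta_part (prime_part P)]).
Proof.
split; first exact: Comp_no_delta.
by move=> dP; split; [exact: Comp_delta|exact: prime_delta_gen|exact: prime_deltaE].
Qed.
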